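(* Let $T$ be a tree. Then (1) $T$ contains no critical $4$-path and no critical $K_{1,3}$; (2) every end-vertex of each insulated $\alpha_3$-critical edge of $T$ has exactly one neighbor in $\mathcal{A}_T$, and this neighbor is an isolated vertex of the induced subgraph $T[\mathcal{A}_T]$; (3) no vertex of a critical $3$-path of $T$ is adjacent to any vertex of $\mathcal{A}_T$.
   Context: A dissociation set of a graph $G$ is a set $S$ of vertices such that $G[S]$ has maximum degree at most $1$; a maximum dissociation set is one of maximum cardinality, which is denoted $\alpha_3(G)$. An edge $e$ is $\alpha_3$-critical if $\alpha_3(G-e)>\alpha_3(G)$, where $G-e$ is obtained by deleting $e$. A subgraph is critical if all its edges are $\alpha_3$-critical; a critical $k$-path is a subgraph isomorphic to the path on $k$ vertices all of whose edges are $\alpha_3$-critical, and a critical $K_{1,3}$ is a subgraph isomorphic to the star with three leaves all of whose edges are $\alpha_3$-critical. An $\alpha_3$-critical edge is insulated if it shares no end-vertex with any other $\alpha_3$-critical edge. $\mathcal{A}_T$ denotes the set of vertices of $T$ that belong to every maximum dissociation set of $T$. *)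

(* Defs.v *)
From mathcomp Require Import all_boot.

Set Implicit Arguments.
Unset Strict Implicit.
Unset Printing Implicit Defensive.

Definition simple_graph (V : finType) (e : rel V) : Prop :=
  symmetric e /\ irreflexive e.

Definition connected_graph (V : finType) (e : rel V) : Prop :=
  forall x y : V, connect e x y.

(* [ucycle e c] also accepts c = [:: x; y] when xy is an edge, so cycles are
   required to have length at least 3. *)
Definition acyclic_graph (V : finType) (e : rel V) : Prop :=
  forall c : seq V, 2 < size c -> ~ ucycle e c.

Definition tree (V : finType) (e : rel V) : Prop :=
  [/\ simple_graph e, 0 < #|V|, connected_graph e & acyclic_graph e].

(* For x in S, the cardinal of this set is the degree of x in the induced
   subgraph on S. *)
Definition nbrs_in (V : finType) (e : rel V) (S : {set V}) (x : V) : {set V} :=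
  [set y in S | e x y].

Definition dissociation (V : finType) (e : rel V) (S : {set V}) : bool :=
  [forall x in S, #|nbrs_in e S x| <= 1].

Definition alpha3 (V : finType) (e : rel V) : nat :=
  \max_(S : {set V} | dissociation e S) #|S|.

Definition max_dissociation (V : finType) (e : rel V) (S : {set V}) : bool :=
  dissociation e S && (#|S| == alpha3 e).

Definition del_edge (V : finType) (e : rel V) (u v : V) : rel V :=
  [rel x y | e x y && ([set x; y] != [set u; v])].

Definition critical_edge (V : finType) (e : rel V) (u v : V) : bool :=
  e u v && (alpha3 e < alpha3 (del_edge e u v)).

(* A subgraph of (V, e) isomorphic to (H, h) with only critical edges is
   presented by an isomorphism f from (H, h) onto it. The subgraph need not be
   induced, so f only has to be injective and to send edges to critical edges
   (which are in particular edges of e). *)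
Definition critical_copy (H V : finType) (h : rel H) (e : rel V) (f : H -> V)
    : Prop :=
  injective f /\ (forall i j : H, h i j -> critical_edge e (f i) (f j)).

Definition path_graph (k : nat) : rel 'I_k :=
  [rel i j : 'I_k | (i.+1 == j :> nat) || (j.+1 == i :> nat)].

(* K_{1,k}, with centre ord0 and the other k vertices as leaves. *)
Definition star_graph (k : nat) : rel 'I_k.+1 :=
  [rel i j : 'I_k.+1 | (i == ord0) != (j == ord0)].

Definition insulated_critical_edge (V : finType) (e : rel V) (u v : V) : Prop :=
  critical_edge e u v /\
  (forall x y : V, critical_edge e x y -> [set x; y] != [set u; v] ->
     [disjoint [set x; y] & [set u; v]]).

(* The set written \mathcal{A}_T. *)
Definition in_all_max (V : finType) (e : rel V) : {set V} :=
  [set x | [forall S : {set V}, max_dissociation e S ==> (x \in S)]].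

Definition isolated_in (V : finType) (e : rel V) (S : {set V}) (x : V) : bool :=
  (x \in S) && (nbrs_in e S x == set0).

(* Main.v *)
(* For adjacent u and c, let B be the component of c in T - u. Call c forced
   (seen from u) if every maximum dissociation set of B contains c, and single
   if some maximum dissociation set of B contains c as an isolated vertex while
   no maximum one avoids c. Computing sizes over the components of B - c gives
   a recursion: c is single iff no neighbour of c other than u is forced (seen
   from c), and c is forced iff it is single or exactly one of these neighbours
   is forced and that one is single. The same rule applied to all neighbours of
   x decides whether x lies in every maximum dissociation set of T. An edge uv
   is critical iff each end is forced seen from the other and they are not both
   single. Hence each end u of a critical edge has one or two forced
   neighbours, and the theorem follows by inspecting these sets. *)
Require Import Defs.
From mathcomp Require Import all_boot.

Set Implicit Arguments.
Unset Strict Implicit.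
Unset Printing Implicit Defensive.

(** * Maximum dissociation sets under side conditions *)

Section Dissociation.

Variables (V : finType) (e : rel V).

Lemma in_nbrs_in (S : {set V}) x y : (y \in nbrs_in e S x) = (y \in S) && e x y.
Proof. by rewrite inE. Qed.

Lemma dissociationP (S : {set V}) :
  reflect (forall x y z, x \in S -> y \in S -> z \in S ->
             e x y -> e x z -> y = z)
          (dissociation e S).
Proof.
apply: (iffP forall_inP) => [dS x y z xS yS zS exy exz | dS x xS].
  by have /card_le1_eqP/(_ z y) := dS x xS; apply; rewrite inE ?yS ?zS.
apply/card_le1_eqP => y z; rewrite !inE => /andP[yS exy] /andP[zS exz].
by rewrite (dS x y z).
Qed.

Lemma dissociationS (S1 S2 : {set V}) :
  S1 \subset S2 -> dissociation e S2 -> dissociation e S1.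
Proof.
move=> /subsetP sS /dissociationP dS; apply/dissociationP => x y z xS yS zS.
by apply: dS; apply: sS.
Qed.

Lemma dissociation_setI (S A : {set V}) :
  dissociation e S -> dissociation e (S :&: A).
Proof. by apply: dissociationS; apply: subsetIl. Qed.

Lemma dissociation0 : dissociation e set0.
Proof. by apply/dissociationP => x y z; rewrite inE. Qed.

(** If no dissociation set satisfies [P], this is the default value 0; hence the side condition of
    [max_card_attained]. *)
Definition max_card (P : pred {set V}) : nat :=
  \max_(S : {set V} | dissociation e S && P S) #|S|.

Lemma leq_max_card (P : pred {set V}) S :
  dissociation e S -> P S -> #|S| <= max_card P.
Proof.
by move=> dS PS; apply: (bigmax_sup S); rewrite ?dS.
Qed.

Lemma max_card_leq (P : pred {set V}) m :
  (forall S, dissociation e S -> P S -> #|S| <= m) -> max_card P <= m.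
Proof. by move=> h; apply/bigmax_leqP => S /andP[]; apply: h. Qed.

Lemma max_card_attained (P : pred {set V}) :
  P set0 \/ 0 < max_card P ->
  exists S, [/\ dissociation e S, P S & #|S| = max_card P].
Proof.
move=> h; have [S0 PS0] : exists S, dissociation e S && P S.
  case: h => [P0|]; first by exists set0; rewrite dissociation0.
  case: (pickP (fun S => dissociation e S && P S)) => [S PS _|P0].
    by exists S.
  by rewrite /max_card big_pred0.
rewrite /max_card (bigmax_eq_arg S0) //.
by case: arg_maxnP => // S /andP[dS PS] _; exists S.
Qed.

Definition full (W : {set V}) := max_card (fun S => S \subset W).
Definition avoid (W : {set V}) c :=
  max_card (fun S => (S \subset W) && (c \notin S)).
Definition isol (W : {set V}) c :=
  max_card (fun S => [&& S \subset W, c \in S & nbrs_in e S c == set0]).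

Lemma full_attained (W : {set V}) :
  exists S, [/\ dissociation e S, S \subset W & #|S| = full W].
Proof. by apply: max_card_attained; left; apply: sub0set. Qed.

Lemma avoid_attained (W : {set V}) c :
  exists S, [/\ dissociation e S, S \subset W, c \notin S & #|S| = avoid W c].
Proof.
have [|S [dS /andP[]]] := @max_card_attained
  (fun S => (S \subset W) && (c \notin S)); last by exists S.
by left; rewrite sub0set inE.
Qed.

Lemma isol_attained (W : {set V}) c : 0 < isol W c ->
  exists S, [/\ dissociation e S, S \subset W, c \in S, nbrs_in e S c = set0
              & #|S| = isol W c].
Proof.
move=> h; have [|S [dS /and3P[sS cS /eqP nS] cardS]] := @max_card_attained
  (fun S => [&& S \subset W, c \in S & nbrs_in e S c == set0]).
  by right.
by exists S.
Qed.

Lemma avoid_leq_full W c : avoid W c <= full W.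
Proof. by apply: max_card_leq => S dS /andP[sS _]; apply: leq_max_card. Qed.

Lemma isol_leq_full W c : isol W c <= full W.
Proof. by apply: max_card_leq => S dS /and3P[sS _ _]; apply: leq_max_card. Qed.

Lemma full_leq_avoid W c : full W <= (avoid W c).+1.
Proof.
apply: max_card_leq => S dS sS.
rewrite (cardsD1 c) -add1n leq_add ?leq_b1 //; apply: leq_max_card.
  by apply: dissociationS dS; apply: subsetDl.
by rewrite !inE eqxx (subset_trans (subsetDl _ _)).
Qed.

Lemma full_setT : full setT = alpha3 e.
Proof. by apply: eq_bigl => S; rewrite subsetT andbT. Qed.

(** Membership in $\mathcal{A}_T$ thus has the same numerical form as [forced], with the whole tree
    in place of a branch. *)
Lemma in_all_maxE x : (x \in in_all_max e) = (avoid setT x < full setT).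
Proof.
rewrite inE; apply/forall_inP/idP => [h | h S /andP[dS /eqP cS]].
  have [S [dS _ xS cS]] := avoid_attained setT x.
  rewrite ltn_neqAle avoid_leq_full andbT -cS; apply: contraNneq xS => cS'.
  by apply: h; rewrite /max_dissociation dS cS' full_setT /=.
apply: contraLR h => xS; rewrite -leqNgt full_setT -cS.
by apply: leq_max_card; rewrite ?subsetT.
Qed.

End Dissociation.

(** * Branches of a tree *)

Section Branches.

Variables (V : finType) (e : rel V).
Hypothesis treeT : tree e.

Let sym_e : symmetric e. Proof. by case: treeT => [[]]. Qed.
Let irr_e : irreflexive e. Proof. by case: treeT => [[]]. Qed.

Lemma edge_neq u c : e u c -> c != u.
Proof. by apply: contraTneq => ->; rewrite irr_e. Qed.

(** T - u is kept on the type [V]: only the edges at u disappear, and u remains as an isolated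
    point. *)
Definition off u : rel V := [rel x y | [&& e x y, x != u & y != u]].

Definition branch u c : {set V} := [set x | connect (off u) c x].

Lemma path_off u c p :
  c != u -> path (off u) c p = path e c p && (u \notin p).
Proof.
elim: p c => [//|x p IHp] c cu; rewrite /= {1}/off /= cu inE negb_or.
rewrite [u == x]eq_sym.
have [_|xu] := eqVneq x u; first by rewrite !andbF.
by rewrite andbT IHp // andbA.
Qed.

Lemma off_connect_sym u : connect_sym (off u).
Proof.
by apply: sym_connect_sym => x y; rewrite /off /= sym_e [(x != u) && _]andbC.
Qed.

(** Acyclicity enters here: a simple path avoiding u between two distinct neighbours of u closes
    through u to a cycle on at least three vertices. *)
Lemma off_connect_nbr u c d : e u c -> e u d -> connect (off u) c d -> c = d.
Proof.
move=> uc ud /connectP[p0 pth0 def_d]; rewrite {}def_d in ud *.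
case: (shortenP pth0) ud => p pth uniq_p _ ud.
case: p pth uniq_p ud => // y p pth uniq_p ud.
move: pth; rewrite path_off ?edge_neq // => /andP[pth up].
case: treeT => _ _ _ /(_ [:: u, c, y & p] isT) []; rewrite /ucycle /= uc.
rewrite rcons_path [e _ u]sym_e (ud : e u (last y p)) andbT.
move: pth uniq_p => /= /andP[-> ->] /andP[-> ->] /=.
by rewrite inE negb_or up eq_sym edge_neq.
Qed.

Lemma branch_root u c : c \in branch u c.
Proof. by rewrite inE connect0. Qed.

Lemma branch_avoid u c : e u c -> u \notin branch u c.
Proof.
move=> uc; rewrite inE; apply/negP => /connectP[p].
rewrite path_off ?edge_neq // => /andP[_ up] def_u.
have := mem_last c p; rewrite -def_u inE (negPf up) orbF eq_sym.
by rewrite (negPf (edge_neq uc)).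
Qed.

Lemma branch_step u c x y : e u c -> x \in branch u c -> e x y -> y != u ->
  y \in branch u c.
Proof.
move=> uc cx xy yu; have xu : x != u.
  by apply: contraTneq cx => ->; apply: branch_avoid.
move: cx; rewrite !inE => cx; apply: connect_trans cx _.
by apply: connect1; rewrite /off /= xy xu.
Qed.

Lemma branch_inj u c d x : e u c -> e u d ->
  x \in branch u c -> x \in branch u d -> c = d.
Proof.
rewrite !inE => uc ud cx dx; apply: (off_connect_nbr uc ud).
by apply: connect_trans cx _; rewrite off_connect_sym.
Qed.

Lemma branch_nbr u c x : e u c -> x \in branch u c -> e u x -> x = c.
Proof. by rewrite inE => uc cx ux; rewrite (off_connect_nbr uc ux cx). Qed.

(** Connectedness enters here: a simple path from u to x leaves u through some c and never returns
    to u. *)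
Lemma branch_cover u x : x != u -> exists2 c, e u c & x \in branch u c.
Proof.
move=> xu; case: treeT => _ _ /(_ u x)/connectP[p0 pth0 def_x] _.
rewrite {}def_x in xu *; case: (shortenP pth0) xu => [[|c p]] pth uniq_p _ /=.
  by rewrite eqxx.
move=> _; move: pth uniq_p => /= /andP[uc pth] /andP[up _]; exists c => //.
move: up; rewrite inE negb_or => /andP[_ up].
rewrite inE; apply/connectP; exists p => //.
by rewrite path_off ?edge_neq // pth.
Qed.

Lemma branch_sub u c d : e u c -> e c d -> d != u ->
  branch c d \subset branch u c.
Proof.
move=> uc cd du; apply/subsetP => x; rewrite inE => /connectP[p].
rewrite path_off ?edge_neq // => /andP[pth cp] ->{x}.
rewrite inE; apply/connectP; exists (d :: p) => //.
rewrite path_off ?edge_neq //= cd pth inE negb_or eq_sym du /=.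
(* If the path from d met u, then d and u would be neighbours of c connected off c, hence equal. *)
apply: contra du => up; apply/eqP.
apply: (off_connect_nbr cd); first by rewrite sym_e.
apply: (path_connect (p := p)); last by rewrite inE up orbT.
by rewrite path_off ?edge_neq // pth.
Qed.

(** A common vertex of the two sides would lie in two different branches at c. A vertex outside
    [branch u c] is u or lies in another branch at u, which [branch_sub] puts inside
    [branch c u]. *)
Lemma branch_opp u c : e u c -> branch c u = ~: branch u c.
Proof.
move=> uc; have cu : e c u by rewrite sym_e.
apply/setP => x; rewrite in_setC; apply/idP/negP => [ux cx | ncx].
  have [xc|xc] := eqVneq x c.
    by move: ux; rewrite xc (negPf (branch_avoid cu)).
  move: cx; rewrite inE => /connectP[p0 pth0 def_x]; rewrite {}def_x in ux xc.
  case: (shortenP pth0) ux xc => [[|d p]] pth uniq_p _ /=; first by rewrite eqxx.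
  move=> ux _; move: pth; rewrite path_off ?edge_neq // inE negb_or.
  case/andP => /andP[cd pth] /andP[ud _]; case/eqP: ud; symmetry.
  apply: (branch_inj cd cu _ ux); rewrite inE; apply/connectP; exists p => //.
  rewrite path_off ?edge_neq // (pth : path e d p) /=.
  by move: uniq_p; rewrite /= inE negb_or => /andP[/andP[]].
have [->|xu] := eqVneq x u; first exact: branch_root.
have [d ud dx] := branch_cover xu.
have dc : d != c by apply: contra_notN ncx => /eqP <-.
exact: (subsetP (branch_sub cu ud dc)).
Qed.

(** All neighbours but one give a branch, all neighbours give T, so that a single recursion serves
    both. *)
Definition subtree u (N : {set V}) : {set V} :=
  u |: \bigcup_(c in N) branch u c.

Lemma branchE u c : e u c -> branch u c = subtree c [set d | e c d && (d != u)].
Proof.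
move=> uc; have cu : e c u by rewrite sym_e.
apply/setP => x; rewrite in_setU1; apply/idP/predU1P => [cx | [->|]].
- have [->|xc] := eqVneq x c; [by left | right].
  have [d cd dx] := branch_cover xc; apply/bigcupP; exists d => //.
  rewrite inE cd; apply: contraTneq dx => ->.
  by rewrite (branch_opp uc) inE cx.
- exact: branch_root.
case/bigcupP => d; rewrite inE => /andP[cd du].
exact: (subsetP (branch_sub uc cd du)).
Qed.

Lemma subtree_setT u : subtree u [set c | e u c] = setT.
Proof.
apply/setP => x; rewrite in_setT in_setU1; have [//|xu /=] := eqVneq x u.
have [c uc cx] := branch_cover xu; apply/bigcupP; exists c => //.
by rewrite inE.
Qed.


Lemma branch_disjoint u c d : e u c -> e u d -> c != d ->
  branch u c :&: branch u d = set0.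
Proof.
move=> uc ud cd; apply/setP => x; rewrite in_setI in_set0.
apply/negP => /andP[cx dx].
by rewrite (branch_inj uc ud cx dx) eqxx in cd.
Qed.

(** * The recursion on branches *)

(* [c] seen from its neighbour [u]. *)
Definition forced u c := avoid e (branch u c) c < full e (branch u c).
(** As [full] exceeds [avoid] by at most one, this inequality makes [isol] equal to [full]. *)
Definition single u c := avoid e (branch u c) c < isol e (branch u c) c.

Lemma single_forced u c : single u c -> forced u c.
Proof. by move/leq_trans; apply; apply: isol_leq_full. Qed.

Lemma full_branch u c : full e (branch u c) = avoid e (branch u c) c + forced u c.
Proof.
apply/eqP; rewrite eqn_leq /forced; case: ltnP => h.
  by rewrite addn1 h full_leq_avoid.
by rewrite addn0 h avoid_leq_full.
Qed.

Lemma isol_branch u c :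
  isol e (branch u c) c <= avoid e (branch u c) c + single u c.
Proof.
rewrite /single; case: ltnP => h; last by rewrite addn0.
by rewrite addn1 (leq_trans (isol_leq_full _ _ _)) // full_leq_avoid.
Qed.

Section Subtree.

Variables (u : V) (N : {set V}).
Hypothesis N_nbr : forall c, c \in N -> e u c.

Lemma card_subtree (S : {set V}) : S \subset subtree u N ->
  #|S| = (u \in S) + \sum_(c in N) #|S :&: branch u c|.
Proof.
move=> sS; rewrite (cardsD1 u); congr (_ + _).
(* Empty pieces outside [N] make the family disjoint over all of [V], as the counting lemma for
   unions requires. *)
pose F c := if c \in N then S :&: branch u c else set0.
have -> : S :\ u = \bigcup_c F c.
  apply/setP => x; rewrite !inE; apply/andP/bigcupP => [[xu xS] | [c _]].
    have := subsetP sS x xS; rewrite in_setU1 (negPf xu) => /bigcupP[c cN cx].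
    by exists c; rewrite // /F cN in_setI xS.
  rewrite /F; case: ifP => [cN|_]; last by rewrite inE.
  case/setIP=> xS cx; split=> //.
  by apply: contraTneq cx => ->; apply/branch_avoid/N_nbr.
rewrite -sum1_card partition_disjoint_bigcup.
  rewrite [RHS]big_mkcond; apply: eq_bigr => c _ /=.
  by rewrite /F sum1_card; case: ifP => // _; rewrite cards0.
move=> c d cd; rewrite /F -setI_eq0; case: ifP => cN; last by rewrite set0I.
case: ifP => dN; last by rewrite setI0.
by rewrite setIACA (branch_disjoint (N_nbr cN) (N_nbr dN) cd) setI0.
Qed.

Section Join.

(** The lower bounds on a subtree come from such sets, with an optimal piece chosen in each
    branch. *)
Definition join (b : bool) (F : V -> {set V}) : {set V} :=
  (if b then [set u] else set0) :|: \bigcup_(c in N) F c.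

Variable F : V -> {set V}.
Hypothesis F_sub : forall c, c \in N -> F c \subset branch u c.

Lemma join_root b : (u \in join b F) = b.
Proof.
rewrite in_setU; case: b; rewrite ?in_set1 ?eqxx // in_set0.
apply/negP => /bigcupP[c cN /(subsetP (F_sub cN))].
by apply/negP/branch_avoid/N_nbr.
Qed.

Lemma join_branch b c : c \in N -> join b F :&: branch u c = F c.
Proof.
move=> cN; apply/setP => x; rewrite in_setI in_setU.
apply/andP/idP => [[/orP[xu|/bigcupP[d dN dx]] cx] | xF].
- case: b xu; rewrite inE // => /eqP xu.
  by rewrite xu (negPf (branch_avoid (N_nbr cN))) in cx.
- by rewrite -(branch_inj (N_nbr dN) (N_nbr cN) (subsetP (F_sub dN) _ dx) cx).
split; last exact: (subsetP (F_sub cN)).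
by apply/orP; right; apply/bigcupP; exists c.
Qed.

Lemma join_sub b : join b F \subset subtree u N.
Proof.
apply/subsetP => x /setUP[xu | /bigcupP[c cN cx]]; rewrite in_setU1.
  by case: b xu; rewrite inE // => ->.
by apply/orP; right; apply/bigcupP; exists c => //; apply: (subsetP (F_sub cN)).
Qed.

Lemma card_join b : #|join b F| = b + \sum_(c in N) #|F c|.
Proof.
rewrite (card_subtree (join_sub b)) join_root; congr (_ + _).
by apply: eq_bigr => c cN; rewrite join_branch.
Qed.

Lemma join_nbr x b : x \in join b F -> e u x -> x \in N /\ x \in F x.
Proof.
move=> /setUP[xu | /bigcupP[c cN cx]] ux.
  by case: b xu; rewrite inE // => /eqP xu; rewrite xu irr_e in ux.
have := branch_nbr (N_nbr cN) (subsetP (F_sub cN) _ cx) ux => xc.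
by rewrite xc in cx *.
Qed.

Lemma join_step b c x y : c \in N -> x \in F c -> y \in join b F -> e x y ->
  y = u /\ x = c \/ y \in F c.
Proof.
move=> cN cx yS xy; have [yu|yu] := eqVneq y u; [left | right].
  split=> //; apply: branch_nbr (N_nbr cN) (subsetP (F_sub cN) _ cx) _.
  by rewrite sym_e -yu.
rewrite -(join_branch b cN) in_setI yS.
exact: branch_step (N_nbr cN) (subsetP (F_sub cN) _ cx) xy yu.
Qed.

(** Distinct pieces communicate only through u. If u is left out, nothing is imposed across pieces;
    if u is put in, it may see one chosen child only, and that child must be isolated in its
    piece. *)
Lemma dissociation_join (b : bool) :
    (forall c, c \in N -> dissociation e (F c)) ->
    (b -> forall c, c \in N -> c \in F c -> nbrs_in e (F c) c = set0) ->
    (b -> forall c d, c \in N -> d \in N -> c \in F c -> d \in F d -> c = d) ->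
  dissociation e (join b F).
Proof.
move=> dF isoF uniqF; apply/dissociationP => x y z xS yS zS xy xz.
have [xu|xu] := eqVneq x u.
  rewrite {}xu join_root in xS xy xz *.
  have [[yN yF] [zN zF]] := (join_nbr yS xy, join_nbr zS xz).
  exact: uniqF.
have {xu} [c cN cx] : exists2 c, c \in N & x \in F c.
  case/setUP: (xS) => [xu'|/bigcupP[c]]; last by exists c.
  by case: (b) xu'; rewrite inE // (negPf xu).
have noedge v : u \in join b F -> x = c -> v \in F c -> e x v -> False.
  rewrite join_root => bT xc vF; rewrite {1}xc => cv.
  have cF : c \in F c by rewrite -{1}xc.
  by have /setP/(_ v) := isoF bT c cN cF; rewrite !inE vF cv.
case: (join_step cN cx yS xy) (join_step cN cx zS xz).
  move=> [yu xc] [[-> _]|zF]; first by [].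
  by case: (noedge z) => //; rewrite -yu.
move=> yF [[zu xc]|zF].
  by case: (noedge y) => //; rewrite -zu.
by move/dissociationP: (dF c cN) => /(_ x y z); apply.
Qed.

End Join.

Let W := subtree u N.

(** Without u the branches are independent. *)
Lemma avoid_subtree : avoid e W u = \sum_(c in N) full e (branch u c).
Proof.
apply/eqP; rewrite eqn_leq; apply/andP; split.
  apply: max_card_leq => S dS /andP[sS uS].
  rewrite (card_subtree sS) (negPf uS); apply: leq_sum => c cN.
  by apply: leq_max_card (dissociation_setI _ dS) _; apply: subsetIr.
have [F FP] := fin_all_exists (fun c => full_attained e (branch u c)).
have F_sub c : c \in N -> F c \subset branch u c by case: (FP c).
have -> : \sum_(c in N) full e (branch u c) = #|join false F|.
  by rewrite (card_join F_sub); apply: eq_bigr => c _; case: (FP c).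
apply: leq_max_card; last by rewrite (join_sub F_sub) (join_root F_sub).
by apply: (dissociation_join F_sub) => // c _; case: (FP c).
Qed.

(** An isolated u excludes every child and counts for one. *)
Lemma isol_subtree : isol e W u = (\sum_(c in N) avoid e (branch u c) c).+1.
Proof.
apply/eqP; rewrite eqn_leq; apply/andP; split.
  apply: max_card_leq => S dS /and3P[sS uS /eqP/setP nS].
  rewrite (card_subtree sS) uS add1n ltnS; apply: leq_sum => c cN.
  apply: leq_max_card (dissociation_setI _ dS) _.
  rewrite subsetIr in_setI branch_root andbT /=.
  by have := nS c; rewrite !inE N_nbr // andbT => ->.
have [F FP] := fin_all_exists (fun c => avoid_attained e (branch u c) c).
have F_sub c : c \in N -> F c \subset branch u c by case: (FP c).
have cF c : c \in F c = false by apply/negbTE; case: (FP c).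
have -> : (\sum_(c in N) avoid e (branch u c) c).+1 = #|join true F|.
  rewrite (card_join F_sub) add1n; congr _.+1.
  by apply: eq_bigr => c _; case: (FP c).
apply: leq_max_card; last first.
  rewrite (join_sub F_sub) (join_root F_sub) /=; apply/eqP/setP => x.
  rewrite in_nbrs_in in_set0; apply/negP => /andP[xS ux].
  by have [_] := join_nbr F_sub xS ux; rewrite cF.
apply: (dissociation_join F_sub) => // [c _|_ c _|_ c d _ _].
- by case: (FP c).
- by rewrite cF.
- by rewrite cF.
Qed.

(** Take u, an optimal set isolating [c0] in its branch, and optimal sets avoiding the other
    children. The two extra units are u and the gain of [isol] over [avoid] at [c0]. *)
Lemma single_leq_full_subtree c0 : c0 \in N -> single u c0 ->
  (\sum_(c in N) avoid e (branch u c) c).+2 <= full e W.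
Proof.
move=> c0N s0; have := isol_attained (leq_ltn_trans (leq0n _) s0).
case=> S0 [dS0 sS0 cS0 nS0 card0].
have [F FP] := fin_all_exists (fun c => avoid_attained e (branch u c) c).
pose G c := if c == c0 then S0 else F c.
have G_sub c : c \in N -> G c \subset branch u c.
  by rewrite /G; have [->|_] := eqVneq c c0; last case: (FP c).
have cG c : c \in G c = (c == c0).
  by rewrite /G; have [->|_] := eqVneq c c0; last by apply/negbTE; case: (FP c).
have le_card : (\sum_(c in N) avoid e (branch u c) c).+2 <= #|join true G|.
  rewrite (card_join G_sub) add1n ltnS (bigD1 c0) //= [in leqRHS](bigD1 c0) //=.
  rewrite -addSn leq_add //; first by rewrite /G eqxx card0.
  apply: leq_sum => c /andP[_ /negPf cc0]; rewrite /G cc0.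
  by case: (FP c) => _ _ _ ->.
apply: leq_trans le_card (leq_max_card _ (join_sub G_sub true)).
apply: (dissociation_join G_sub) => [c _|_ c _|_ c d _ _].
- by rewrite /G; case: ifP => // _; case: (FP c).
- by rewrite cG => /eqP ->; rewrite /G eqxx.
- by rewrite !cG => /eqP -> /eqP ->.
Qed.

(** The first term is the optimum without u. With u, at most one child is chosen, it is isolated in
    its branch, and it gains one over [avoid] only if it is single. *)
Lemma full_subtree :
  full e W = maxn (\sum_(c in N) full e (branch u c))
    (\sum_(c in N) avoid e (branch u c) c + [exists c in N, single u c]).+1.
Proof.
apply/eqP; rewrite eqn_leq geq_max -avoid_subtree avoid_leq_full /=.
apply/andP; split; last first.
  case: exists_inP => [[c]|_].
    by rewrite addn1; apply: single_leq_full_subtree.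
  by rewrite addn0 -isol_subtree isol_leq_full.
apply: max_card_leq => S dS sS; rewrite leq_max.
have [uS|uS] := boolP (u \in S); last first.
  by rewrite leq_max_card // sS.
apply/orP; right; rewrite (card_subtree sS) uS add1n ltnS.
(* A chosen child c already has the neighbour u in [S], so it is isolated within its own branch. *)
have le_branch c : c \in N ->
    #|S :&: branch u c| <= avoid e (branch u c) c + ((c \in S) && single u c).
  move=> cN; have dSc := dissociation_setI (branch u c) dS.
  have [cS|cS] /= := boolP (c \in S); last first.
    by rewrite addn0 leq_max_card // subsetIr in_setI (negPf cS).
  apply: leq_trans (isol_branch u c); apply: leq_max_card => //.
  rewrite subsetIr in_setI cS branch_root /=; apply/eqP/setP => x.
  rewrite in_nbrs_in in_set0 in_setI; apply/negP => /andP[/andP[xS cx] exc].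
  have uc := N_nbr cN; have cu : e c u by rewrite sym_e.
  move: cx; rewrite -(dissociationP _ _ dS c u x cS uS xS cu exc).
  by rewrite (negPf (branch_avoid uc)).
apply: (@leq_trans (\sum_(c in N) (avoid e (branch u c) c +
    ((c \in S) && single u c)))); first exact: leq_sum.
rewrite big_split leq_add2l -big_mkcondr sum1_card.
have le1 : #|[pred c in N | (c \in S) && single u c]| <= 1.
  apply/card_le1_eqP => c d /and3P[cN cS _] /and3P[dN dS' _].
  by rewrite (dissociationP _ _ dS u c d) // N_nbr.
case: exists_inP => // no_single; rewrite leqn0; apply/eqP/eq_card0 => c.
by apply/negP => /and3P[cN _ sc]; apply: no_single; exists c.
Qed.

(** * Counting forced children *)

Definition forced_children := [set c in N | forced u c].

Lemma sum_full : \sum_(c in N) full e (branch u c) =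
  \sum_(c in N) avoid e (branch u c) c + #|forced_children|.
Proof.
under eq_bigr do rewrite full_branch.
rewrite big_split -big_mkcondr -sum1_card; congr (_ + _).
by apply: eq_bigl => c; rewrite inE.
Qed.

(** With A the sum of the [avoid] values and k the number of forced children, the two sides are A +
    k and A + 1. *)
Lemma subtree_single : (avoid e W u < isol e W u) = (forced_children == set0).
Proof.
rewrite avoid_subtree isol_subtree sum_full ltnS -[leqRHS]addn0 leq_add2l.
by rewrite leqn0 cards_eq0.
Qed.

(** Here A + k is below the maximum of A + k and A + s + 1, where s is 1 if some child is single and
    0 otherwise. So k is at most s, and a single child, being forced, is then the only forced
    one. *)
Lemma subtree_forced : avoid e W u < full e W ->
  forced_children = set0 \/
  exists2 c, forced_children = [set c] & single u c.
Proof.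
rewrite full_subtree avoid_subtree leq_max ltnn ltnS sum_full leq_add2l /=.
case: exists_inP => [[c cN sc] | _]; last first.
  by rewrite leqn0 cards_eq0 => /eqP; left.
move=> le1; right; exists c => //; apply/esym/eqP.
rewrite eqEcard cards1 le1 sub1set inE cN andbT.
exact: single_forced.
Qed.

Lemma forced_subtree0 : forced_children = set0 -> avoid e W u < full e W.
Proof.
move=> M0; apply: leq_trans (isol_leq_full e W u).
by rewrite subtree_single M0.
Qed.

Lemma forced_subtree1 c :
  forced_children = [set c] -> single u c -> avoid e W u < full e W.
Proof.
move=> Mc sc; rewrite full_subtree avoid_subtree leq_max ltnn ltnS sum_full.
rewrite leq_add2l Mc cards1; case: exists_inP => // -[]; exists c => //.
by have := set11 c; rewrite -Mc inE => /andP[].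
Qed.

End Subtree.

(** * Cutting an edge *)

Lemma cut_edge u v x y : e u v -> e x y -> x \in branch u v ->
  y \in branch v u -> x = v /\ y = u.
Proof.
move=> uv xy vx uy; have [yu|yu] := eqVneq y u.
  by split=> //; apply: branch_nbr uv vx _; rewrite sym_e -yu.
by move: uy; rewrite (branch_opp uv) in_setC (branch_step uv vx xy yu).
Qed.

Lemma in_branch_opp u v x : e u v -> (x \in branch v u) = (x \notin branch u v).
Proof. by move=> uv; rewrite (branch_opp uv) in_setC. Qed.

Lemma card_cut u v (S : {set V}) : e u v ->
  #|S| = #|S :&: branch u v| + #|S :&: branch v u|.
Proof. by move=> uv; rewrite (branch_opp uv) -setDE cardsID. Qed.

(** Only v has a neighbour across the cut, namely u; if both are chosen, v has no further chosen
    neighbour on its side. *)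
Lemma dissociation_cut_half u v (S : {set V}) : e u v ->
    dissociation e (S :&: branch u v) ->
    (u \in S -> v \in S -> nbrs_in e (S :&: branch u v) v = set0) ->
  forall x y z, x \in S -> x \in branch u v -> y \in S -> z \in S ->
    e x y -> e x z -> y = z.
Proof.
move=> uv /dissociationP dS isoS x y z xS vx yS zS xy xz.
have cross w t : w \in S -> w \notin branch u v -> e x w ->
    t \in S -> t \in branch u v -> e x t -> False.
  rewrite -in_branch_opp // => wS uw xw tS vt xt.
  have [xv wu] := cut_edge uv xw vx uw; rewrite {}wu {}xv in wS xS xt.
  have /setP/(_ t) := isoS wS xS.
  by rewrite in_nbrs_in in_set0 in_setI tS vt xt.
have [vy|vy] := boolP (y \in branch u v);
  have [vz|vz] := boolP (z \in branch u v).
- by apply: (dS x); rewrite ?in_setI ?xS ?yS ?zS.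
- by case: (cross z y).
- by case: (cross y z).
move: vy vz; rewrite -!in_branch_opp // => vy vz.
by have [[_ ->] [_ ->]] := (cut_edge uv xy vx vy, cut_edge uv xz vx vz).
Qed.

Lemma dissociation_cut u v (S : {set V}) : e u v ->
    dissociation e (S :&: branch u v) -> dissociation e (S :&: branch v u) ->
    (u \in S -> v \in S -> nbrs_in e (S :&: branch u v) v = set0 /\
                          nbrs_in e (S :&: branch v u) u = set0) ->
  dissociation e S.
Proof.
move=> uv dv du iso; have vu : e v u by rewrite sym_e.
apply/dissociationP => x y z xS yS zS.
have [vx|] := boolP (x \in branch u v).
  by apply: (dissociation_cut_half uv dv) => // uS vS; case: (iso uS vS).
rewrite -in_branch_opp // => ux.
by apply: (dissociation_cut_half vu du) => // vS uS; case: (iso uS vS).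
Qed.

(** * Dissociation sets after deletion of an edge *)

Lemma del_edge_branch u v x y : e u v -> x \in branch u v -> y \in branch u v ->
  del_edge e u v x y = e x y.
Proof.
move=> uv vx vy; rewrite /del_edge /= andb_idr // => _.
apply/eqP => /setP/(_ u); rewrite !inE eqxx /=.
have nu := negPf (branch_avoid uv).
by case/orP=> /eqP def_u; rewrite -def_u nu in vx vy.
Qed.

Lemma del_edgeC u v : del_edge e u v =2 del_edge e v u.
Proof. by move=> x y; rewrite /del_edge /= [[set v; u]]setUC. Qed.

Lemma del_edge_stay u v x y : e u v -> x \in branch u v ->
  del_edge e u v x y -> e x y /\ y \in branch u v.
Proof.
move=> uv vx /andP[xy nuv]; split=> //; apply: contraR nuv => vy.
rewrite -in_branch_opp // in vy; have [-> ->] := cut_edge uv xy vx vy.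
by rewrite setUC.
Qed.

Lemma dissociation_del_edge_branch u v (S : {set V}) : e u v ->
  dissociation (del_edge e u v) S -> dissociation e (S :&: branch u v).
Proof.
move=> uv /dissociationP dS; apply/dissociationP => x y z.
move=> /setIP[xS vx] /setIP[yS vy] /setIP[zS vz].
rewrite -(del_edge_branch uv vx vy) -(del_edge_branch uv vx vz); exact: dS.
Qed.

Lemma dissociation_del_edge u v (S : {set V}) : e u v ->
    dissociation e (S :&: branch u v) -> dissociation e (S :&: branch v u) ->
  dissociation (del_edge e u v) S.
Proof.
move=> uv /dissociationP dv /dissociationP du; have vu : e v u by rewrite sym_e.
apply/dissociationP => x y z xS yS zS.
have [vx|] := boolP (x \in branch u v).
  case/(del_edge_stay uv vx) => xy vy /(del_edge_stay uv vx) [xz vz].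
  by apply: (dv x); rewrite ?in_setI ?xS ?yS ?zS.
rewrite -in_branch_opp // !(del_edgeC u v) => ux.
case/(del_edge_stay vu ux) => xy uy /(del_edge_stay vu ux) [xz uz].
by apply: (du x); rewrite ?in_setI ?xS ?yS ?zS.
Qed.

Lemma setU_cut u v (S1 S2 : {set V}) : e u v ->
    S1 \subset branch u v -> S2 \subset branch v u ->
  (S1 :|: S2) :&: branch u v = S1.
Proof.
move=> uv s1 s2; apply/setP => x; rewrite in_setI in_setU.
have [xS1|xS1] /= := boolP (x \in S1); first by rewrite (subsetP s1).
apply/negP => /andP[/(subsetP s2)]; rewrite in_branch_opp //.
by move/negPf->.
Qed.

(** The deleted tree is the disjoint union of the two branches, on which optima are chosen
    independently. *)
Lemma alpha3_del_edge u v : e u v ->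
  alpha3 (del_edge e u v) = full e (branch u v) + full e (branch v u).
Proof.
move=> uv; have vu : e v u by rewrite sym_e.
apply/eqP; rewrite eqn_leq; apply/andP; split.
  apply/bigmax_leqP => S dS; rewrite (card_cut S uv) leq_add //.
    by rewrite leq_max_card ?subsetIr ?dissociation_del_edge_branch.
  rewrite leq_max_card ?subsetIr ?dissociation_del_edge_branch //.
  apply/dissociationP => x y z; rewrite -!(del_edgeC u v).
  exact/dissociationP.
have [S1 [d1 s1 <-]] := full_attained e (branch u v).
have [S2 [d2 s2 <-]] := full_attained e (branch v u).
have [E1 E2] := (setU_cut uv s1 s2, setU_cut vu s2 s1); rewrite setUC in E2.
apply: (bigmax_sup (S1 :|: S2)); last first.
  by rewrite (card_cut (S1 :|: S2) uv) E1 E2.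
by apply: dissociation_del_edge; rewrite ?E1 ?E2.
Qed.

Lemma avoid_full_leq_alpha3 u v : e u v ->
  avoid e (branch u v) v + full e (branch v u) <= alpha3 e.
Proof.
move=> uv; have vu : e v u by rewrite sym_e.
have [S1 [d1 s1 n1 <-]] := avoid_attained e (branch u v) v.
have [S2 [d2 s2 <-]] := full_attained e (branch v u).
have [E1 E2] := (setU_cut uv s1 s2, setU_cut vu s2 s1); rewrite setUC in E2.
apply: (bigmax_sup (S1 :|: S2)); last first.
  by rewrite (card_cut (S1 :|: S2) uv) E1 E2.
apply: (dissociation_cut uv); rewrite ?E1 ?E2 // => _.
rewrite in_setU (negPf n1) => /(subsetP s2).
by rewrite (negPf (branch_avoid vu)).
Qed.

Lemma isol_isol_leq_alpha3 u v : e u v -> single u v -> single v u ->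
  isol e (branch u v) v + isol e (branch v u) u <= alpha3 e.
Proof.
move=> uv sv su; have vu : e v u by rewrite sym_e.
have [S1 [d1 s1 _ i1 <-]] := isol_attained (leq_ltn_trans (leq0n _) sv).
have [S2 [d2 s2 _ i2 <-]] := isol_attained (leq_ltn_trans (leq0n _) su).
have [E1 E2] := (setU_cut uv s1 s2, setU_cut vu s2 s1); rewrite setUC in E2.
apply: (bigmax_sup (S1 :|: S2)); last first.
  by rewrite (card_cut (S1 :|: S2) uv) E1 E2.
by apply: (dissociation_cut uv); rewrite ?E1 ?E2.
Qed.

(** The three bounds treat sets missing v, sets missing u, and sets containing both, where each end
    is isolated on its side. *)
Lemma alpha3_leq u v m : e u v ->
    avoid e (branch u v) v + full e (branch v u) <= m ->
    full e (branch u v) + avoid e (branch v u) u <= m ->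
    isol e (branch u v) v + isol e (branch v u) u <= m ->
  alpha3 e <= m.
Proof.
move=> uv m1 m2 m3; apply/bigmax_leqP => S dS; rewrite (card_cut S uv).
have d1 := dissociation_setI (branch u v) dS.
have d2 := dissociation_setI (branch v u) dS.
have [vS|vS] := boolP (v \in S); last first.
  by apply: leq_trans m1;
    rewrite leq_add ?leq_max_card ?subsetIr ?in_setI ?(negPf vS).
have [uS|uS] := boolP (u \in S); last first.
  by apply: leq_trans m2;
    rewrite leq_add ?leq_max_card ?subsetIr ?in_setI ?(negPf uS).
have iso a b : e a b -> a \in S -> b \in S ->
    nbrs_in e (S :&: branch a b) b = set0.
  move=> ab aS bS; apply/setP => x; rewrite in_nbrs_in in_set0 in_setI.
  apply/negP => /andP[/andP[xS bx] exb]; have ba : e b a by rewrite sym_e.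
  move: bx; rewrite -(dissociationP _ _ dS b a x bS aS xS ba exb).
  by rewrite (negPf (branch_avoid ab)).
have vu : e v u by rewrite sym_e.
apply: leq_trans m3; apply: leq_add; apply: leq_max_card => //.
  by rewrite subsetIr in_setI vS branch_root /= iso.
by rewrite subsetIr in_setI uS branch_root /= iso.
Qed.

(** Criticality says that the three kinds of sets in [alpha3_leq] all stay below the sum of the two
    [full] values. For the first two kinds this is forcedness of v and of u; given that, it fails
    for the third exactly when both ends are single. *)
Lemma critical_edgeE u v : critical_edge e u v =
  [&& e u v, forced u v, forced v u & ~~ (single u v && single v u)].
Proof.
rewrite /critical_edge; have [uv|//] /= := boolP (e u v).
have vu : e v u by rewrite sym_e.
rewrite (alpha3_del_edge uv); apply/idP/and3P => [lt_alpha | [fv fu]].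
  split.
  - have := leq_ltn_trans (avoid_full_leq_alpha3 uv) lt_alpha.
    by rewrite ltn_add2r.
  - have := leq_ltn_trans (avoid_full_leq_alpha3 vu) lt_alpha.
    by rewrite [leqRHS]addnC ltn_add2r.
  apply/negP => /andP[sv su]; have := isol_isol_leq_alpha3 uv sv su.
  rewrite leqNgt (leq_trans lt_alpha) // leq_add //.
    exact: leq_trans (full_leq_avoid _ _ _) sv.
  exact: leq_trans (full_leq_avoid _ _ _) su.
have [iv iu] := (isol_leq_full e (branch u v) v, isol_leq_full e (branch v u) u).
(* [alpha3_leq] is applied to the predecessor of the sum, which is positive because v is forced. *)
rewrite -[ltnRHS]prednK ?ltnS; last by rewrite addn_gt0 (leq_ltn_trans _ fv).
move=> ns; apply: (alpha3_leq uv); rewrite -ltnS prednK; 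
  rewrite ?addn_gt0 ?(leq_ltn_trans _ fv) //.
- by rewrite ltn_add2r.
- by rewrite ltn_add2l.
move: ns; rewrite negb_and /single -!leqNgt => /orP[le_v | le_u].
  by rewrite -addSn leq_add // (leq_ltn_trans le_v).
by rewrite -addnS leq_add // (leq_ltn_trans le_u).
Qed.

(** * Forced neighbours and critical edges *)

Definition forced_nbrs u := [set c | e u c && forced u c].

Lemma forced_children_nbrs u : forced_children u [set c | e u c] = forced_nbrs u.
Proof. by apply/setP => c; rewrite !inE. Qed.

Lemma forced_children_branch u c :
  forced_children c [set d | e c d && (d != u)] = forced_nbrs c :\ u.
Proof. by apply/setP => d; rewrite !inE andbAC andbC. Qed.

Let nbr_branch u c d : d \in [set d | e c d && (d != u)] -> e c d.
Proof. by rewrite inE => /andP[]. Qed.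

Let nbr_all u c : c \in [set c | e u c] -> e u c.
Proof. by rewrite inE. Qed.

Lemma singleE u c : e u c -> single u c = (forced_nbrs c :\ u == set0).
Proof.
move=> uc; rewrite /single (branchE uc) subtree_single; last exact: nbr_branch.
by rewrite forced_children_branch.
Qed.

Lemma forced_cases u c : e u c -> forced u c ->
  forced_nbrs c :\ u = set0 \/
  exists2 d, forced_nbrs c :\ u = [set d] & single c d.
Proof.
move=> uc; rewrite /forced (branchE uc) => /(subtree_forced (@nbr_branch u c)).
by rewrite forced_children_branch.
Qed.

Lemma forced_nbrs1 u c d : e u c ->
  forced_nbrs c :\ u = [set d] -> single c d -> forced u c.
Proof.
move=> uc; rewrite /forced (branchE uc) -forced_children_branch.
exact/forced_subtree1/nbr_branch.
Qed.

Lemma forced_nbrs0 u c : e u c -> forced_nbrs c :\ u = set0 -> forced u c.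
Proof. by move=> uc M0; apply: single_forced; rewrite singleE // M0. Qed.

Lemma in_all_max_cases x : x \in in_all_max e ->
  forced_nbrs x = set0 \/ exists2 d, forced_nbrs x = [set d] & single x d.
Proof.
rewrite in_all_maxE -(subtree_setT x) => /(subtree_forced (@nbr_all x)).
by rewrite forced_children_nbrs.
Qed.

Lemma forced_nbrs0_in_all_max x : forced_nbrs x = set0 -> x \in in_all_max e.
Proof.
move=> M0; rewrite in_all_maxE -(subtree_setT x).
by apply: (forced_subtree0 (@nbr_all x)); rewrite forced_children_nbrs.
Qed.

Lemma in_forced_nbrs u c : e u c -> (c \in forced_nbrs u) = forced u c.
Proof. by rewrite inE => ->. Qed.

Lemma forced_nbrsD1 a x : e a x -> ~~ forced a x ->
  forced_nbrs a :\ x = forced_nbrs a.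
Proof.
move=> ax nx; apply/setP => y; rewrite in_setD1 andb_idl //.
by apply: contraTneq => ->; rewrite in_forced_nbrs.
Qed.

(* A non-forced neighbour [x] does not influence the recursion at [a]. *)
Lemma in_all_max_forced x a : e x a -> a \in in_all_max e ->
  ~~ forced a x -> forced x a.
Proof.
move=> xa aA nx; have ax : e a x by rewrite sym_e.
have Ma := forced_nbrsD1 ax nx.
case: (in_all_max_cases aA) => [M0 | [d Md sd]].
  by apply: forced_nbrs0; rewrite ?Ma.
by apply: (forced_nbrs1 (d := d)); rewrite ?Ma.
Qed.

(** * Adjacent critical edges, critical 4-paths and critical claws *)

Lemma critical_sym u v : critical_edge e u v = critical_edge e v u.
Proof.
rewrite !critical_edgeE sym_e !andbA; congr (_ && ~~ _); last by rewrite andbC.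
by rewrite andbAC.
Qed.

Lemma critical_forced_nbr u v : critical_edge e u v -> v \in forced_nbrs u.
Proof. by rewrite critical_edgeE inE => /and4P[-> ->]. Qed.

(** Seen from v, the vertex u is forced although w is a forced neighbour; so w is the only one and
    is single, which leaves w no forced neighbour but u. The roles of v and w are symmetric. *)
Lemma critical_pair u v w : critical_edge e u v -> critical_edge e u w ->
    v != w ->
  [/\ forced_nbrs u = [set v; w], forced_nbrs v = [set u]
    & forced_nbrs w = [set u]].
Proof.
have half a b : critical_edge e u a -> critical_edge e u b -> a != b ->
    forced_nbrs u :\ a = [set b] /\ forced_nbrs b = [set u].
  move=> ca cb ab; have au : e a u.
    by move: ca; rewrite critical_sym critical_edgeE => /and4P[].
  have fu : forced a u by move: ca; rewrite critical_edgeE => /and4P[].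
  have ub : e u b by move: cb; rewrite critical_edgeE => /and4P[].
  have bM : b \in forced_nbrs u :\ a.
    by rewrite in_setD1 eq_sym ab critical_forced_nbr.
  case: (forced_cases au fu) => [M0|[d Md sd]]; first by rewrite M0 inE in bM.
  have bd : b = d by apply/set1P; rewrite -Md.
  rewrite -{}bd in Md sd; split=> //.
  have uM : u \in forced_nbrs b.
    by apply: critical_forced_nbr; rewrite critical_sym.
  apply/eqP; rewrite -(setD1K uM) eqEsubset subsetUl andbT.
  by move: sd; rewrite singleE // => /eqP->; rewrite setU0.
move=> cv cw vw; have [Mv Mw] := half v w cv cw vw.
have [_ Nv] := half w v cw cv (contra_neq (@esym _ _ _) vw).
by rewrite Nv Mw -Mv setD1K // critical_forced_nbr.
Qed.

Lemma no_critical_P4 : ~ exists f : 'I_4 -> V, critical_copy (@path_graph 4) e f.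
Proof.
case=> f [inj_f crit_f]; pose x (i : nat) := f (inord i).
have crit i : i < 3 -> critical_edge e (x i) (x i.+1).
  move=> i3; apply: crit_f; rewrite /path_graph /= !inordK ?eqxx //.
  by rewrite (ltn_trans i3).
have neq_x : x 1 != x 3 by rewrite (inj_eq inj_f) -val_eqE /= !inordK.
have neq_x' : x 2 != x 0 by rewrite (inj_eq inj_f) -val_eqE /= !inordK.
have c10 : critical_edge e (x 1) (x 0) by rewrite critical_sym crit.
(* The critical edges at [x 1] leave [x 1] as the only forced neighbour of [x 2], but the third edge
   makes [x 3] another. *)
have [_ M2 _] := critical_pair (crit 1 isT) c10 neq_x'.
have := critical_forced_nbr (crit 2 isT); rewrite M2 inE eq_sym.
by rewrite (negPf neq_x).
Qed.

Lemma no_critical_claw :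
  ~ exists f : 'I_4 -> V, critical_copy (@star_graph 3) e f.
Proof.
case=> f [inj_f crit_f]; pose x (i : nat) := f (inord i).
have crit i : 0 < i < 4 -> critical_edge e (x 0) (x i).
  case/andP=> i0 i4; apply: crit_f.
  rewrite /star_graph /= -!val_eqE /= !inordK //.
  by rewrite -lt0n i0.
have neq_x i j : i < 4 -> j < 4 -> i != j -> x i != x j.
  by move=> i4 j4 ij; rewrite (inj_eq inj_f) -val_eqE /= !inordK.
(* Two critical edges already exhaust the forced neighbours of the centre, so the third leaf has no
   place. *)
have [M0 _ _] := critical_pair (crit 1 isT) (crit 2 isT)
  (neq_x 1 2 isT isT isT).
have := critical_forced_nbr (crit 3 isT); rewrite M0 !inE.
by rewrite (negPf (neq_x 3 1 isT isT isT)) (negPf (neq_x 3 2 isT isT isT)).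
Qed.

(** * Critical 3-paths and the vertices in all maximum sets *)

Lemma forced_pair_not_in_all_max x c d :
  c \in forced_nbrs x -> d \in forced_nbrs x -> c != d -> x \notin in_all_max e.
Proof.
move=> cM dM cd; apply/negP => /in_all_max_cases [M0|[b Mb _]].
  by rewrite M0 inE in cM.
by move: cM dM cd; rewrite Mb !inE => /eqP-> /eqP->; rewrite eqxx.
Qed.

Lemma not_forced_pair a x c d : e a x ->
  c \in forced_nbrs x -> d \in forced_nbrs x ->
  a != c -> a != d -> c != d -> ~~ forced a x.
Proof.
move=> ax cM dM ac ad cd; apply/negP => /(forced_cases ax).
have cM' : c \in forced_nbrs x :\ a by rewrite in_setD1 eq_sym ac.
have dM' : d \in forced_nbrs x :\ a by rewrite in_setD1 eq_sym ad.
case=> [M0|[b Mb _]]; first by rewrite M0 inE in cM'.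
by move: cM' dM' cd; rewrite Mb !inE => /eqP-> /eqP->; rewrite eqxx.
Qed.

(** Here u is the middle vertex. If x is not forced seen from a, then [in_all_max_forced] makes a a
    forced neighbour of x; but those all lie on the path, and no path vertex is in every maximum
    set. *)
Lemma critical_P3_nbr u v w x a : critical_edge e u v -> critical_edge e u w ->
    v != w -> x \in [set u; v] -> a \in in_all_max e -> ~~ e x a.
Proof.
move=> cv cw vw xuv aA; apply/negP => xa.
have ax : e a x by rewrite sym_e.
have [Mu Mv Mw] := critical_pair cv cw vw.
have [vM wM] := (critical_forced_nbr cv, critical_forced_nbr cw).
have au : a != u.
  by apply: contraTneq aA => ->; apply: forced_pair_not_in_all_max vM wM vw.
have not_single b c : e u b -> c \in forced_nbrs u -> c != b -> ~~ single b u.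
  move=> ub cM cb; rewrite singleE 1?sym_e //; apply/set0Pn; exists c.
  by rewrite in_setD1 cb.
have leaf_not_all b c : forced_nbrs b = [set u] -> e u b ->
    c \in forced_nbrs u -> c != b -> b \notin in_all_max e.
  move=> Mb ub cM cb; apply/negP => /in_all_max_cases; rewrite Mb.
  case=> [/setP/(_ u)|[d /setP/(_ u)]]; rewrite !inE eqxx //.
  by move=> /esym/eqP <-; apply/negP; apply: not_single cM cb.
have uv : e u v by move: vM; rewrite inE => /andP[].
have uw : e u w by move: wM; rewrite inE => /andP[].
case/set2P: xuv => [xu|xv].
  rewrite {}xu in xa ax *.
  have av : a != v.
    by apply: contraTneq aA => ->; apply: leaf_not_all Mv uv wM _; rewrite eq_sym.
  have aw : a != w.
    by apply: contraTneq aA => ->; apply: leaf_not_all Mw uw vM _.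
  have := in_all_max_forced xa aA (not_forced_pair ax vM wM av aw vw).
  by rewrite -in_forced_nbrs // Mu !inE (negPf av) (negPf aw).
rewrite {}xv in xa ax *.
(* Away from a, the only forced neighbour of v is u, which is not single because of w. *)
have nf : ~~ forced a v.
  have Mva : forced_nbrs v :\ a = [set u].
    rewrite Mv; apply/setP => y; rewrite !inE andb_idl // => /eqP->.
    by rewrite eq_sym.
  apply/negP => /(forced_cases ax); rewrite Mva.
  case=> [/setP/(_ u)|[d /setP/(_ u)]]; rewrite !inE eqxx //.
  by move=> /esym/eqP <-; apply/negP; apply: not_single wM _; rewrite // eq_sym.
have := in_all_max_forced xa aA nf.
by rewrite -in_forced_nbrs // Mv inE (negPf au).
Qed.

(** * Insulated critical edges *)

Lemma insulated_sym u v :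
  insulated_critical_edge e u v -> insulated_critical_edge e v u.
Proof. by case=> cuv ins; split; rewrite 1?critical_sym // [[set v; u]]setUC. Qed.

(** If v were single, criticality would give u a further forced neighbour w. Seen from w, the vertex
    u would be forced through v but not single, so uw would be a critical edge meeting uv. *)
Lemma insulated_not_single u v :
  insulated_critical_edge e u v -> ~~ single u v.
Proof.
case=> cuv ins; apply/negP => sv.
move: (cuv); rewrite critical_edgeE sv /= => /and4P[uv fv fu nsu].
have vu : e v u by rewrite sym_e.
case: (forced_cases vu fu) => [M0|[w Mw sw]].
  by rewrite singleE // M0 eqxx in nsu.
have : w \in forced_nbrs u :\ v by rewrite Mw set11.
rewrite in_setD1 inE => /and3P[wv uw fw].
have wu : e w u by rewrite sym_e.
have vM : v \in forced_nbrs u :\ w by rewrite in_setD1 eq_sym wv inE uv.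
have Mv : forced_nbrs u :\ w = [set v].
  have vM' : v \in forced_nbrs u by rewrite inE uv.
  rewrite -(setD1K vM') Mw; apply/setP => y; rewrite !inE.
  by have [->|] := eqVneq y w; rewrite ?orbF //= (negPf wv).
have fwu : forced w u := forced_nbrs1 wu Mv sv.
have nswu : ~~ single w u by rewrite singleE //; apply/set0Pn; exists v.
have cuw : critical_edge e u w.
  by rewrite critical_edgeE uw fw fwu negb_and nswu orbT.
have : [set u; w] != [set u; v].
  apply/eqP => /setP/(_ w); rewrite !inE eqxx orbT (negPf wv) orbF.
  by rewrite (negPf (edge_neq uw)).
by move/(ins _ _ cuw)/disjoint_setI0/setP/(_ u); rewrite !inE eqxx.
Qed.

Lemma insulated_forced_nbrs u v : insulated_critical_edge e u v ->
  exists w, [/\ w != v, forced_nbrs u = [set v; w] & single u w].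
Proof.
move=> ins; have nsu := insulated_not_single (insulated_sym ins).
have [cuv _] := ins; have vM := critical_forced_nbr cuv.
move: cuv; rewrite critical_edgeE => /and4P[uv _ fu _].
have vu : e v u by rewrite sym_e.
case: (forced_cases vu fu) => [M0|[w Mw sw]].
  by rewrite singleE // M0 eqxx in nsu.
exists w; split=> //; last by rewrite -(setD1K vM) Mw.
by have := set11 w; rewrite -Mw in_setD1 => /andP[].
Qed.

(** The witness is the second forced neighbour w of u. Any other a in $\mathcal{A}_T$ adjacent to u
    would be forced seen from u, hence equal to v or w; and v is excluded since it too has two
    forced neighbours. *)
Lemma insulated_nbr u v : insulated_critical_edge e u v ->
  exists2 w, nbrs_in e (in_all_max e) u = [set w]
    & isolated_in e (in_all_max e) w.
Proof.
move=> ins; have nsv := insulated_not_single ins.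
have [w [wv Mu sw]] := insulated_forced_nbrs ins.
have [z [zu Mv _]] := insulated_forced_nbrs (insulated_sym ins).
have [vM wM] : v \in forced_nbrs u /\ w \in forced_nbrs u.
  by rewrite Mu set21 set22.
have uA : u \notin in_all_max e.
  by apply: forced_pair_not_in_all_max wM vM wv.
have vA : v \notin in_all_max e.
  by apply: (forced_pair_not_in_all_max _ _ zu); rewrite Mv ?set21 ?set22.
have uw : e u w by move: wM; rewrite inE => /andP[].
have wu : e w u by rewrite sym_e.
(* Seen from w, u has the forced neighbour v, which is not single; so w has no forced neighbour at
   all. *)
have nfu : ~~ forced w u.
  apply/negP => /(forced_cases wu).
  have vMw : v \in forced_nbrs u :\ w by rewrite in_setD1 eq_sym wv.
  case=> [M0|[d Md sd]]; first by rewrite M0 inE in vMw.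
  by move: vMw nsv; rewrite Md => /set1P->; rewrite sd.
have Mw : forced_nbrs w = set0.
  by move: sw; rewrite singleE // forced_nbrsD1 // => /eqP.
have wA := forced_nbrs0_in_all_max Mw.
exists w.
  apply/setP => a; rewrite in_nbrs_in inE; apply/andP/eqP => [[aA ua]|->] //.
  have au : e a u by rewrite sym_e.
  apply/eqP; apply: contraT => aw.
  have av : a != v by apply: contraTneq aA => ->.
  have vw : v != w by rewrite eq_sym.
  have := in_all_max_forced ua aA (not_forced_pair au vM wM av aw vw).
  by rewrite -in_forced_nbrs // Mu !inE (negPf av) (negPf aw).
rewrite /isolated_in wA; apply/eqP/setP => a; rewrite in_nbrs_in in_set0.
apply/negP => /andP[aA wa]; have aw : e a w by rewrite sym_e.
(* Since w is forced seen from a, it is the only forced neighbour of a; then a is forced seen from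
   w, which has no forced neighbour. *)
have wMa : w \in forced_nbrs a.
  by rewrite in_forced_nbrs // forced_nbrs0 // Mw set0D.
have Ma : forced_nbrs a :\ w = set0.
  case: (in_all_max_cases aA) => [M0|[d Md _]]; first by rewrite M0 set0D.
  by move: wMa; rewrite Md => /set1P->; rewrite setDv.
by have := forced_nbrs0 wa Ma; rewrite -in_forced_nbrs // Mw inE.
Qed.

End Branches.

Theorem theorem3p6 (V : finType) (e : rel V) (treeT : tree e) :
  [/\ (~ (exists f : 'I_4 -> V, critical_copy (@path_graph 4) e f)) /\
      (~ (exists f : 'I_4 -> V, critical_copy (@star_graph 3) e f)),
      forall u v : V, insulated_critical_edge e u v ->
        forall x : V, x \in [set u; v] ->
        exists2 w : V, nbrs_in e (in_all_max e) x = [set w]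
                     & isolated_in e (in_all_max e) w
    & forall f : 'I_3 -> V, critical_copy (@path_graph 3) e f ->
        forall (i : 'I_3) (a : V), a \in in_all_max e -> ~~ e (f i) a].
Proof.
split; first by split; [apply: no_critical_P4 | apply: no_critical_claw].
  move=> u v ins x /set2P[] ->; first exact: (insulated_nbr treeT ins).
  exact: (insulated_nbr treeT (insulated_sym treeT ins)).
move=> f [inj_f crit_f] i a aA.
pose x (k : nat) : V := f (inord k).
have c0 : critical_edge e (x 1) (x 0).
  by apply: crit_f; rewrite /path_graph /= !inordK.
have c2 : critical_edge e (x 1) (x 2).
  by apply: crit_f; rewrite /path_graph /= !inordK.
have neq : x 0 != x 2 by rewrite (inj_eq inj_f) -val_eqE /= !inordK.
have -> : f i = x i by rewrite /x inord_val.
(* Index 1 is the middle of the path; for index 2 the two edges exchange roles. *)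
case: i => [[|[|[|//]]]] i3 /=.
- by apply: (critical_P3_nbr treeT c0 c2 neq _ aA); rewrite set22.
- by apply: (critical_P3_nbr treeT c0 c2 neq _ aA); rewrite set21.
- by apply: (critical_P3_nbr treeT c2 c0 _ _ aA); rewrite 1?eq_sym ?set22.
Qed.
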